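(* For every bipartite graph $G$, the Hilbert space $L_2(G)$ is the orthogonal direct sum of the subspaces $L_2^*(F)$, where $F$ ranges over all subgraphs $F \subseteq G$: $$L_2(G) = \bigoplus^{\perp}_{F \subseteq G} L_2^*(F).$$
   Context: Let $(\xi_i)_{i\ge1}$, $(\eta_j)_{j\ge1}$, $(\zeta_{ij})_{i,j\ge1}$ be mutually independent random variables, each uniformly distributed on $[0,1]$. A bipartite graph $G=(V_1(G),V_2(G),E(G))$ consists of a finite set of row vertices $V_1(G)\subset\mathbb N$, a finite set of column vertices $V_2(G)\subset\mathbb N$ (row vertices and column vertices are regarded as different objects), and a set of edges $E(G)\subseteq V_1(G)\times V_2(G)$. Vertex sets may be empty; $\emptyset$ denotes the graph with no vertices. $F\subseteq G$ (subgraph) means $V_1(F)\subseteq V_1(G)$, $V_2(F)\subseteq V_2(G)$, $E(F)\subseteq (V_1(F)\times V_2(F))\cap E(G)$; $F\subset G$ means $F\subseteq G$ and $F\ne G$. $H(G)=\big((\xi_i)_{i\in V_1(G)},(\eta_j)_{j\in V_2(G)},(\zeta_{ij})_{(i,j)\in E(G)}\big)$. $L_2(G)$ is the Hilbert space of all square-integrable real random variables measurable with respect to $\sigma(H(G))$, with inner product $\langle X,X'\rangle=\mathbb E[XX']$ (random variables that are a.s. equal are identified; $L_2(\emptyset)$ is the space of constants). Finally $$L_2^*(G)=\{X\in L_2(G):\ \mathbb E[X\mid H(F)]=0 \text{ for all } F\subset G\}.$$ *)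

(* Defs.v *)
From HB Require Import structures.
From mathcomp Require Import all_boot all_order all_algebra finmap.
From mathcomp Require Import all_classical all_reals all_analysis.

Set Implicit Arguments.
Unset Strict Implicit.
Unset Printing Implicit Defensive.

Import Order.TTheory GRing.Theory Num.Theory.
Import numFieldNormedType.Exports.

Local Open Scope classical_set_scope.
Local Open Scope ring_scope.

(* Row and column vertices are told apart by the field they occur in, so the
   same number may name both a row vertex and a column vertex. *)
Record bigraph := Bigraph {
  rows : {fset nat};
  cols : {fset nat};
  edges : {fset nat * nat};
  edges_sub : (edges `<=` rows `*` cols)%fset
}.

HB.instance Definition _ := gen_eqMixin bigraph.
HB.instance Definition _ := gen_choiceMixin bigraph.

Definition subgraph (F G : bigraph) : bool :=
  [&& (rows F `<=` rows G)%fset, (cols F `<=` cols G)%fset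
    & (edges F `<=` edges G)%fset].

Definition proper_subgraph (F G : bigraph) : bool := subgraph F G && (F != G).

Lemma finite_subgraphs (G : bigraph) : finite_set [set F | subgraph F G].
Proof.
pose code F := (rows F, cols F, edges F).
have code_inj : injective code.
  move=> [r c e s] [r' c' e' s'] [] /= rr cc ee.
  by subst; congr Bigraph; exact: bool_irrelevance.
pose S := (fpowerset (rows G) `*` fpowerset (cols G)
           `*` fpowerset (edges G))%fset.
apply: (@sub_finite_set _ _ (code @^-1` [set` S])); last first.
  by apply: finite_preimage; [move=> x y _ _; exact: code_inj|exact: finite_fset].
by move=> F /= /and3P[rF cF eF]; rewrite !in_fsetM /= !fpowersetE rF cF eF.
Qed.

(* Index set of the whole array: inl (inl i) stands for xi_i, inl (inr j) for
   eta_j and inr (i, j) for zeta_ij. *)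
Definition site : choiceType := (nat + nat + nat * nat)%type.

Definition sites (G : bigraph) : set site :=
  [set s | match s with
           | inl (inl i) => i \in rows G
           | inl (inr j) => j \in cols G
           | inr e => e \in edges G
           end].

Section probability_space.
Context {d : measure_display} {T : measurableType d} {R : realType}.
Variable P : probability T R.

Definition mutually_independent {I : choiceType} (X : I -> {RV P >-> R}) :=
  forall (J : {fset I}) (B : I -> set R),
    (forall i, measurable (B i)) ->
    P (\bigcap_(i in [set` J]) (X i @^-1` B i)) =
    (\prod_(i <- J) P (X i @^-1` B i))%E.

(* Measures take arbitrary values on non-measurable sets, so the two laws are
   compared on Borel sets only. *)
Definition uniform01 (X : {RV P >-> R}) :=
  forall B : set R, measurable B ->
    distribution P X B = uniform_prob (@ltr01 R) B.

(* In the next two definitions S is a sub-sigma-algebra of T. *)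
Definition measurable_wrt (S : set (set T)) (X : T -> R) :=
  preimage_set_system [set: T] X measurable `<=` S.

(* Y is a version of E[X | S]. *)
Definition is_cond_expectation (S : set (set T)) (X Y : T -> R) :=
  [/\ measurable_wrt S Y,
      P.-integrable [set: T] (EFin \o Y) &
      forall A, S A ->
        (\int[P]_(w in A) (Y w)%:E = \int[P]_(w in A) (X w)%:E)%E].

Definition linear_subspace (V : set (T -> R)) :=
  [/\ V (cst 0),
      forall X Y, V X -> V Y -> V (X \+ Y) &
      forall (a : R) X, V X -> V (fun w => a * X w)].

(* V and W i are spaces of functions, standing for their images in the Hilbert
   space of classes modulo almost sure equality; for that reason the
   decomposition and its uniqueness hold almost surely.  D must be finite,
   since a sum over an infinite support is 0 by convention. *)
Definition orthogonal_direct_sum {I : choiceType}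
    (V : set (T -> R)) (D : set I) (W : I -> set (T -> R)) :=
  [/\ linear_subspace V,
      forall i, D i -> linear_subspace (W i) /\ W i `<=` V,
      forall i j X Y, D i -> D j -> i != j -> W i X -> W j Y ->
        ('E_P[X \* Y] = 0)%E &
      forall X, V X -> exists Y : I -> T -> R,
        [/\ forall i, D i -> W i (Y i),
            X = (fun w => \sum_(i \in D) Y i w) %[ae P] &
            forall Z : I -> T -> R, (forall i, D i -> W i (Z i)) ->
              X = (fun w => \sum_(i \in D) Z i w) %[ae P] ->
              forall i, D i -> Z i = Y i %[ae P]]].

Variables (xi eta : nat -> {RV P >-> R}) (zeta : nat -> nat -> {RV P >-> R}).

Definition array (s : site) : {RV P >-> R} :=
  match s with
  | inl (inl i) => xi i
  | inl (inr j) => eta j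
  | inr (i, j) => zeta i j
  end.

Definition sigmaH (G : bigraph) : set (set T) :=
  <<s \bigcup_(s in sites G)
        preimage_set_system [set: T] (array s) measurable >>.

Definition L2 (G : bigraph) : set (T -> R) :=
  [set X | X \in Lfun P 2%:E /\ measurable_wrt (sigmaH G) X].

(* E[X | H(F)] = 0 almost surely means that 0 is a version of it. *)
Definition L2star (G : bigraph) : set (T -> R) :=
  [set X | L2 G X /\
    forall F, proper_subgraph F G ->
      is_cond_expectation (sigmaH F) X (cst 0)].

End probability_space.

(* Main.v *)
From HB Require Import structures.
Require Import Defs.
From mathcomp Require Import all_boot all_order all_algebra finmap.
From mathcomp Require Import all_classical all_reals all_analysis.
From mathcomp Require Import measurable_realfun lebesgue_integral measure.
From mathcomp Require Import ring lra.

(** The sigma-algebras sigma(H(F)) satisfy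
<<
      E[ E[X | H(F)] | H(F') ] = E[X | H(F /\ F')]
>>
    because the whole array is independent, and this turns the decomposition
    into Moebius inversion on the poset of subgraphs.

    The conditional expectations themselves are mostly avoided: E[X | S] = 0 is
    used in the form that X integrates to 0 over every event of S, called
    [centred] below.  Two facts about it carry the proof.
    - [integral_centredM]: a variable centred on S is orthogonal to every
      S-measurable variable.
    - [centred_sigma]: if Y depends on the coordinates in S only, and is centred
      on the sigma-algebra of the coordinates in both S and S', then it is
      centred on the sigma-algebra of the coordinates in S'.  On a cylinder over
      S' this is seen by splitting off the coordinates outside S, which are
      independent of Y; cylinders form a pi-system.

    Orthogonality.  If F is not a subgraph of F', the meet of F and F' is a
    proper subgraph of F, so a variable of L2*(F) is centred on the meet, hence
    on F' ([L2star_centred]), hence orthogonal to L2(F').  Two different graphs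
    cannot be subgraphs of each other, so this covers all pairs.

    Existence.  Let Z_F be the projection E[X | H(F)], obtained from the
    Radon-Nikodym theorem and shown to be square-integrable by truncation, and
    define Y_F recursively by Z_F = sum of Y_F' over the subgraphs F' of F.
    For H a proper subgraph of F,
<<
      Y_F = (X - sum_(F' <= H) Y_F') - (X - Z_F) - sum_(F' < F, not F' <= H) Y_F'
>>
    and each of the three terms is centred on H: the first by the recursion, the
    second by definition of Z_F, the third by [L2star_centred].  Hence Y_F lies
    in L2*(F).  For F = G the difference X - sum_(F' <= G) Y_F' is both
    sigma(H(G))-measurable and centred on sigma(H(G)), so it is orthogonal to
    itself.

    Uniqueness follows from orthogonality. *)

Set Implicit Arguments.
Unset Strict Implicit.
Unset Printing Implicit Defensive.

Import Order.TTheory GRing.Theory Num.Theory.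
Import numFieldNormedType.Exports HBNNSimple.

Local Open Scope classical_set_scope.
Local Open Scope ring_scope.

(** * Spaces of functions *)

Lemma linear_subspace_sum d (T : measurableType d) (R : realType)
    (V : set (T -> R)) (I : Type) (s : seq I) (Q : pred I) (X : I -> T -> R) :
  linear_subspace V -> (forall i, Q i -> V (X i)) ->
  V (fun w => \sum_(i <- s | Q i) X i w).
Proof.
move=> [V0 VD _] VX; elim: s => [|i s IHs].
  suff -> : (fun w => \sum_(i <- [::] | Q i) X i w) = cst 0 by [].
  by apply/funext => w; rewrite big_nil.
suff -> : (fun w => \sum_(j <- i :: s | Q j) X j w) =
    (fun w => (if Q i then X i w else 0) + \sum_(j <- s | Q j) X j w).
  by case Qi: (Q i); apply: VD => //; exact: VX.
by apply/funext => w; rewrite big_cons; case: ifP; rewrite ?add0r.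
Qed.

Lemma linear_subspaceB d (T : measurableType d) (R : realType)
    (V : set (T -> R)) (X Y : T -> R) :
  linear_subspace V -> V X -> V Y -> V (X \- Y).
Proof.
move=> [_ VD VZ] VX VY.
have -> : X \- Y = X \+ (fun w => -1 * Y w) by apply/funext => w /=; rewrite mulN1r.
exact/VD/VZ.
Qed.

(** * Measurability with respect to a generated sigma-algebra *)

Lemma g_sigma_sub_measurable d (T : measurableType d) (G : set (set T)) :
  G `<=` measurable -> <<s G >> `<=` measurable.
Proof. by move=> Gm; apply: smallest_sub => //; exact: sigma_algebra_measurable. Qed.

(** [g_sigma_algebraType G] is T equipped with the sigma-algebra generated by G;
    the closure properties below come from those of measurable functions on it. *)
Lemma measurable_wrtP d (T : measurableType d) (R : realType) (G : set (set T))
    (Y : T -> R) :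
  measurable_wrt <<s G >> Y <->
  measurable_fun ([set: T] : set (g_sigma_algebraType G)) Y.
Proof.
by split => [GY _ B mB|mY _ [B mB <-]]; [apply: GY; exists B|exact: mY].
Qed.

Section wrt.
Context d (T : measurableType d) (R : realType) (G : set (set T)).
Implicit Types X Y : T -> R.

Lemma measurable_wrtT X : G `<=` measurable -> measurable_wrt <<s G >> X ->
  measurable_fun [set: T] X.
Proof.
by move=> Gm mX _ B mB; apply: (g_sigma_sub_measurable Gm); apply: mX; exists B.
Qed.

Lemma measurable_wrt_cst (r : R) : measurable_wrt <<s G >> (cst r : T -> R).
Proof. by apply/measurable_wrtP. Qed.

Lemma measurable_wrtD X Y : measurable_wrt <<s G >> X ->
  measurable_wrt <<s G >> Y -> measurable_wrt <<s G >> (X \+ Y).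
Proof.
move=> /measurable_wrtP mX /measurable_wrtP mY; apply/measurable_wrtP.
exact: measurable_funD.
Qed.

Lemma measurable_wrtM X Y : measurable_wrt <<s G >> X ->
  measurable_wrt <<s G >> Y -> measurable_wrt <<s G >> (X \* Y).
Proof.
move=> /measurable_wrtP mX /measurable_wrtP mY; apply/measurable_wrtP.
exact: measurable_funM.
Qed.

Lemma measurable_wrt_norm X : measurable_wrt <<s G >> X ->
  measurable_wrt <<s G >> (Num.norm \o X).
Proof.
move=> /measurable_wrtP mX; apply/measurable_wrtP.
exact: measurableT_comp.
Qed.

Lemma measurable_wrt_indic A : <<s G >> A -> measurable_wrt <<s G >> (\1_A : T -> R).
Proof.
by move=> GA; apply/measurable_wrtP; exact: measurable_indic.
Qed.

End wrt.

(** * Functions with vanishing integrals over a sigma-algebra *)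

Lemma integrable_mul_indic d (T : measurableType d) (R : realType)
    (mu : {measure set T -> \bar R}) (X : T -> R) (A : set T) :
  mu.-integrable [set: T] (EFin \o X) -> measurable A ->
  mu.-integrable [set: T] (EFin \o (X \* \1_A)).
Proof.
move=> intX mA.
have /(integrable_mkcond _ mA) := integrableS measurableT mA (@subsetT _ _) intX.
by rewrite epatch_indic.
Qed.

Lemma integral_mul_indic d (T : measurableType d) (R : realType)
    (mu : {measure set T -> \bar R}) (X : T -> R) (A : set T) :
  (\int[mu]_w (X w * \1_A w)%:E = \int[mu]_(w in A) (X w)%:E)%E.
Proof. by rewrite [RHS]integral_mkcond (epatch_indic (EFin \o X)). Qed.

Section centred.
Context d (T : measurableType d) (R : realType) (mu : {measure set T -> \bar R}).

(** When S is a sub-sigma-algebra and mu a probability, this says that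
    E[X | S] = 0 almost surely. *)
Definition centred (S : set (set T)) : set (T -> R) :=
  [set X : T -> R | mu.-integrable [set: T] (EFin \o X) /\
    forall A, S A -> (\int[mu]_(w in A) (X w)%:E = 0)%E].

Lemma centred_subspace S : S `<=` measurable -> linear_subspace (centred S).
Proof.
move=> Sm; split.
- split; first exact: integrable0.
  by move=> A _; rewrite integral0.
- move=> X Y [intX X0] [intY Y0]; split.
    exact: eq_integrable (integrableD measurableT intX intY).
  move=> A SA; have mA := Sm _ SA.
  rewrite (integralD_EFin mA).
  + by rewrite X0// Y0// adde0.
  + exact: integrableS intX.
  + exact: integrableS intY.
- move=> a X [intX X0]; split.
    exact: eq_integrable (integrableZl measurableT a intX).
  move=> A SA; have mA := Sm _ SA.
  under eq_integral do rewrite EFinM.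
  by rewrite integralZl// ?X0 ?mule0//; exact: integrableS intX.
Qed.

Lemma centred_sub S S' : S `<=` S' -> centred S' `<=` centred S.
Proof. by move=> SS' X [intX X0]; split => // A /SS'; exact: X0. Qed.

(** The events over which X integrates to 0 form a Dynkin system. *)
Lemma centred_g_sigma (G : set (set T)) (X : T -> R) :
  G `<=` measurable -> setI_closed G ->
  (\int[mu]_w (X w)%:E = 0)%E -> centred G X -> centred <<s G >> X.
Proof.
move=> Gm GI XT [intX XG]; split => // A.
rewrite -setI_closed_g_dynkin_g_sigma_algebra//.
suff /[apply] : <<d G >> `<=`
  [set B | measurable B /\ (\int[mu]_(w in B) (X w)%:E = 0)%E] by case.
have intS B : measurable B -> mu.-integrable B (EFin \o X).
  by move=> mB; exact: (integrableS measurableT).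
apply: smallest_sub => [|B GB]; last by split; [exact: Gm|exact: XG].
split => /=; first by split.
- move=> B [mB XB]; split; first exact: measurableC.
  have := @integral_setU _ _ _ mu B (~` B) (EFin \o X) mB (measurableC mB).
  rewrite setUv XT XB add0e => <- //.
  + exact: measurable_int intX.
  + by apply/disj_set2P; rewrite setICr.
- move=> F tF mF.
  have mU : measurable (\bigcup_n F n).
    by apply: bigcup_measurable => n _; case: (mF n).
  split => //; rewrite (@integral_bigcup _ _ _ mu F (EFin \o X))//.
  + by apply: eseries0 => n _ _; case: (mF n).
  + by move=> n; case: (mF n).
  + exact: intS.
Qed.

Let integral_centredM_ge0 (G : set (set T)) (X Y : T -> R) :
  G `<=` measurable -> centred <<s G >> X ->
  measurable_wrt <<s G >> Y -> (forall w, 0 <= Y w) ->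
  mu.-integrable [set: T] (EFin \o (X \* Y)) ->
  (\int[mu]_w (X w * Y w)%:E = 0)%E.
Proof.
move=> Gm [intX X0] mY Y0 intXY.
have mEY : measurable_fun ([set: T] : set (g_sigma_algebraType G)) (EFin \o Y).
  exact/measurable_EFinP/measurable_wrtP.
pose phi := nnsfun_approx measurableT mEY.
have cphi w : (phi n w)%:E @[n --> \oo] --> (Y w)%:E.
  by apply: cvg_nnsfun_approx => // x _; rewrite lee_fin.
have phiY n w : phi n w <= Y w.
  rewrite -lee_fin /phi nnsfun_approxE.
  apply: (@le_approx _ (g_sigma_algebraType G) _ _ (EFin \o Y)) => //.
  by move=> x _; rewrite lee_fin.
have mX : measurable_fun [set: T] X.
  by apply/measurable_EFinP; exact: measurable_int intX.
have mphi n : measurable_wrt <<s G >> (phi n).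
  by apply/measurable_wrtP; exact: measurable_funPT.
have GA n y : <<s G >> (phi n @^-1` [set y]).
  by apply: (mphi n); exists [set y] => //; rewrite setTI.
have mA n y : measurable (phi n @^-1` [set y] : set T).
  exact: g_sigma_sub_measurable (GA n y).
have {}mphi n : measurable_fun [set: T] (phi n : T -> R).
  by move=> _ B mB; apply: (g_sigma_sub_measurable Gm); apply: (mphi n); exists B.
have : (\int[mu]_w (X w * phi n w)%:E)%E @[n --> \oo] --> (\int[mu]_w (X w * Y w)%:E)%E.
  have := @dominated_convergence _ _ _ mu setT measurableT
    (fun n w => (X w * phi n w)%:E) (fun w => (X w * Y w)%:E)
    (fun w => `|(X w * Y w)%:E|%E).
  case => //.
  - by move=> n; apply/measurable_EFinP; exact: measurable_funM.
  - exact: measurable_int intXY.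
  - apply: aeW => w _ /=; under eq_fun do rewrite EFinM.
    by rewrite EFinM; apply: cvgeZl.
  - exact: integrable_abse.
  - apply: aeW => w n _ /=; rewrite lee_fin !normrM ler_wpM2l//.
    by rewrite !ger0_norm// (phiY n).
(* The n-th integral is a finite combination of integrals of X over the level
   sets of phi n, which are events of the generated sigma-algebra. *)
suff -> : (fun n => \int[mu]_w (X w * phi n w)%:E)%E = cst 0%E.
  by move=> /cvg_lim <- //; rewrite lim_cst.
apply/funext => n.
under eq_integral => w _.
  rewrite (fimfunE (phi n) w) fsbig_finite//= big_distrr/= -sumEFin.
  over.
have intX1 y : mu.-integrable [set: T] (EFin \o (X \* \1_(phi n @^-1` [set y]))).
  exact: integrable_mul_indic.
under eq_integral => w _.
  under eq_bigr => y _ do rewrite mulrCA EFinM.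
  over.
rewrite integral_sum//= => [|y]; last exact: (integrableZl measurableT _ (intX1 y)).
rewrite big1// => y _; rewrite integralZl//; last exact: intX1.
by rewrite (integral_mul_indic mu X) X0 ?mule0.
Qed.

(** The sign of Y is removed by writing Y = (|Y| + Y) - |Y|; nonnegative Y are
    limits of simple functions, under the dominating function |X * Y|. *)
Lemma integral_centredM (G : set (set T)) (X Y : T -> R) :
  G `<=` measurable -> centred <<s G >> X -> measurable_wrt <<s G >> Y ->
  mu.-integrable [set: T] (EFin \o (X \* Y)) ->
  (\int[mu]_w (X w * Y w)%:E = 0)%E.
Proof.
move=> Gm CX mY intXY; have [intX _] := CX.
have mnY := measurable_wrt_norm mY.
have intXn : mu.-integrable [set: T] (EFin \o (X \* (Num.norm \o Y))).
  apply: le_integrable intXY => //.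
    apply/measurable_EFinP/measurable_funM.
      by apply/measurable_EFinP; exact: measurable_int intX.
    exact: measurable_wrtT mnY.
  by move=> w _ /=; rewrite lee_fin !normrM normr_id.
have intXD : mu.-integrable [set: T] (EFin \o (X \* ((Num.norm \o Y) \+ Y))).
  apply: eq_integrable (integrableD _ intXn intXY) => // w _ /=.
  by rewrite -EFinD mulrDr.
have -> : (\int[mu]_w (X w * Y w)%:E =
    \int[mu]_w (X w * (`|Y w| + Y w))%:E - \int[mu]_w (X w * `|Y w|)%:E)%E.
  rewrite -integralB_EFin//; apply: eq_integral => w _.
  by rewrite -EFinB -mulrBr addrAC subrr add0r.
have mDY : measurable_wrt <<s G >> (Num.norm \o Y \+ Y) by exact: measurable_wrtD.
have DY0 w : 0 <= (Num.norm \o Y \+ Y) w.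
  by rewrite /= -lerBlDr sub0r ler_normr lexx orbT.
have /= -> := integral_centredM_ge0 Gm CX mDY DY0 intXD.
have nY0 w : 0 <= (Num.norm \o Y) w by rewrite /=.
by have /= -> := integral_centredM_ge0 Gm CX mnY nY0 intXn; rewrite sube0.
Qed.

Definition orthocomplement (U : T -> R) : set (T -> R) :=
  [set X : T -> R | mu.-integrable [set: T] (EFin \o (U \* X)) /\
    (\int[mu]_w (U w * X w)%:E = 0)%E].

Lemma orthocomplement_subspace U : linear_subspace (orthocomplement U).
Proof.
split.
- rewrite /orthocomplement /=; split.
    apply: eq_integrable (integrable0 mu setT) => // w _ /=; by rewrite mulr0.
  by under eq_integral do rewrite mulr0; rewrite integral0.
- move=> X Y [intX X0] [intY Y0]; split.
    apply: eq_integrable (integrableD measurableT intX intY) => // w _ /=.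
    by rewrite mulrDr EFinD.
  under eq_integral do rewrite mulrDr EFinD.
  by rewrite (integralD measurableT intX intY) X0 Y0 adde0.
- move=> a X [intX X0]; split.
    apply: eq_integrable (integrableZl measurableT a intX) => // w _ /=.
    by rewrite mulrCA.
  under eq_integral do rewrite mulrCA EFinM.
  by rewrite (integralZl measurableT intX) X0 mule0.
Qed.

End centred.

(** * Square-integrable functions and conditional expectations *)

Lemma Lfun2_integral_sqr d (T : measurableType d) (R : realType)
    (mu : {measure set T -> \bar R}) (Z : T -> R) :
  measurable_fun [set: T] Z -> (\int[mu]_w (Z w ^+ 2)%:E < +oo)%E ->
  Z \in Lfun mu 2%:E.
Proof.
move=> mZ Zoo; rewrite inE; apply/andP; split; rewrite inE//=.
rewrite /finite_norm unlock poweR_lty//.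
by under eq_integral => w _ do
  rewrite /= powR_mulrn// real_normK ?num_real//.
Qed.

Section square_integrable.
Context d (T : measurableType d) (R : realType) (P : probability T R).

Lemma Lfun2_integrable (X : T -> R) : X \in Lfun P 2%:E ->
  P.-integrable [set: T] (EFin \o X).
Proof.
by move=> X2; apply/Lfun1_integrable/Lfun_subset12 => //; exact: fin_num_measure.
Qed.

Lemma integrable_Lfun2M (X Y : T -> R) : X \in Lfun P 2%:E -> Y \in Lfun P 2%:E ->
  P.-integrable [set: T] (EFin \o (X \* Y)).
Proof. by move=> X2 Y2; apply/Lfun1_integrable/Lfun2_mul_Lfun1. Qed.

Lemma Lfun2_sqr0_ae (X : T -> R) : X \in Lfun P 2%:E ->
  (\int[P]_w (X w * X w)%:E = 0)%E -> X = cst 0 %[ae P].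
Proof.
move=> X2 X0.
have mXX := measurable_int _ (integrable_Lfun2M X2 X2).
have /(ae_eq_integral_abs P measurableT mXX) :
    (\int[P]_w `|(EFin \o (X \* X)%R) w| = 0)%E.
  rewrite -[RHS]X0; apply: eq_integral => w _ /=.
  by rewrite ger0_norm// -expr2 sqr_ge0.
apply: filterS => w /= /(_ I) [XX0] _.
by apply/eqP; rewrite -sqrf_eq0 expr2 XX0.
Qed.

(** The conditional expectation of X is the density with respect to P of the
    charge with density X, when both are restricted to the sub-sigma-algebra.
    That restriction is the image under the identity map from T to T with the
    coarser sigma-algebra. *)
Lemma cond_expectation_exists (G : set (set T)) (X : T -> R) :
  G `<=` measurable -> P.-integrable [set: T] (EFin \o X) ->
  exists Z : T -> R, is_cond_expectation P <<s G >> X Z.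
Proof.
move=> Gm intX.
pose T' : measurableType _ := g_sigma_algebraType G.
have mid : measurable_fun [set: T] (id : T -> T').
  by move=> _ B mB; rewrite setTI; exact: (g_sigma_sub_measurable Gm).
pose idRV : {RV P >-> T'} :=
  HB.pack (id : T -> T') (isMeasurableFun.Build _ _ _ _ _ mid).
pose Q : probability T' R := distribution P idRV.
pose nu := fun A : set T' => (\int[P]_(w in A) (X w)%:E)%E.
have nu0 : nu set0 = 0%E by rewrite /nu integral_set0.
have finnu A : measurable A -> nu A \is a fin_num.
  move=> /(g_sigma_sub_measurable Gm) mA.
  by apply: integrable_fin_num => //; exact: integrableS intX.
have snu : semi_sigma_additive nu.
  move=> F mF tF mUF.
  apply: (@charge_semi_sigma_additive _ _ _ (induced_charge intX)) => //.
    by move=> n; apply: (g_sigma_sub_measurable Gm); exact: mF.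
  exact: (g_sigma_sub_measurable Gm).
pose nuC : {charge set T' -> \bar R} :=
  HB.pack nu (isCharge.Build _ _ _ nu nu0 finnu snu).
have numu : nuC `<< Q.
  apply/null_content_dominatesP => A mA QA0.
  apply: null_set_integral => //.
    exact: (g_sigma_sub_measurable Gm).
  by apply: (measurable_funS measurableT) => //; exact: measurable_int intX.
pose f := Radon_Nikodym nuC Q.
have intf : Q.-integrable setT f := Radon_Nikodym_integrable numu.
have ff x : f x \is a fin_num by exact: Radon_Nikodym_fin_num.
have fE : f = EFin \o (fine \o f) by apply/funext => x /=; rewrite fineK.
have mf : measurable_fun [set: T'] f := measurable_int _ intf.
have intPf : P.-integrable [set: T] (EFin \o (fine \o f)).
  rewrite -fE; apply/integrableP; split.
    by move=> _ B mB; apply: (g_sigma_sub_measurable Gm); exact: mf.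
  have /integrableP[_] := intf.
  by rewrite /Q ge0_integral_distribution//; exact: measurableT_comp.
exists (fine \o f); split => //.
- apply/measurable_wrtP/measurable_EFinP.
  by rewrite -fE.
- move=> A GA.
  transitivity (nuC A) => //.
  rewrite (Radon_Nikodym_integral numu GA) -/f integral_pushforward//.
    by apply: eq_integral => w _; rewrite /= fineK.
  rewrite fE; apply: integrableS intPf => //.
  exact: (g_sigma_sub_measurable Gm).
Qed.

Lemma cond_expectation_centred (S : set (set T)) (X Z : T -> R) :
  S `<=` measurable -> P.-integrable [set: T] (EFin \o X) ->
  is_cond_expectation P S X Z -> centred P S (X \- Z).
Proof.
move=> Sm intX [_ intZ ZX].
split; first exact: eq_integrable (integrableB measurableT intX intZ).
move=> A SA; have mA := Sm _ SA.
under eq_integral do rewrite EFinB.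
rewrite integralB_EFin//; [|exact: integrableS intX|exact: integrableS intZ].
by rewrite ZX// subee//; apply: integrable_fin_num => //; exact: integrableS intX.
Qed.

(** Conditional expectation contracts the L2 norm.  With Z_n the truncation of Z
    to the event |Z| <= n, the identity E[(X - Z) Z_n] = 0 gives
    E[Z_n^2] = E[2 (X - Z) Z_n + Z_n^2], where the integrand is at most X^2;
    then let n tend to infinity.  The truncation makes the products integrable
    before Z is known to be square-integrable. *)
Lemma cond_expectation_Lfun2 (G : set (set T)) (X Z : T -> R) :
  G `<=` measurable -> X \in Lfun P 2%:E ->
  is_cond_expectation P <<s G >> X Z -> Z \in Lfun P 2%:E.
Proof.
move=> Gm X2 EZ; have [GZ intZ ZX] := EZ.
have intX := Lfun2_integrable X2.
have mZ := measurable_wrtT Gm GZ.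
have mnZ := measurable_wrt_norm GZ.
pose B n := [set w | `|Z w| <= n%:R].
have GB n : <<s G >> (B n).
  apply: mnZ; exists `]-oo, n%:R]%classic => //.
  by rewrite setTI; apply/seteqP; split => w /=; rewrite in_itv.
have mB n := g_sigma_sub_measurable Gm (GB n).
pose D := X \- Z.
have CD : centred P <<s G >> D.
  by apply: cond_expectation_centred => //; exact: g_sigma_sub_measurable.
have [intD _] := CD.
have X2i := Lfun2_integrable_sqr X2.
pose Zn n := Z \* \1_(B n).
have GZn n : measurable_wrt <<s G >> (Zn n).
  by apply: measurable_wrtM => //; exact: measurable_wrt_indic.
have Zn_le n w : `|Zn n w| <= n%:R.
  rewrite /Zn /= indicE; have [|_] := boolP (w \in B n).
    by rewrite inE mulr1.
  by rewrite mulr0 normr0.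
have Zn_len n w : `|Zn n w| <= `|n%:R : R| by rewrite (le_trans (Zn_le _ _))// ler_norm.
have Zn_bnd n : P.-integrable [set: T] (EFin \o Zn n).
  have intn := finite_measure_integrable_cst P n%:R measurableT.
  apply: (le_integrable measurableT _ _ intn).
    exact/measurable_EFinP/(measurable_wrtT Gm).
  by move=> w _ /=; rewrite lee_fin; exact: Zn_len.
have intDZ n : P.-integrable [set: T] (EFin \o (D \* Zn n)).
  apply: (le_integrable measurableT _ _ (integrableZl measurableT n%:R intD)).
    apply/measurable_EFinP/measurable_funM; last exact: (measurable_wrtT Gm).
    by apply/measurable_EFinP; exact: measurable_int intD.
  move=> w _ /=; rewrite lee_fin (normrM (D w)) (normrM n%:R) mulrC ler_wpM2r//.
have int2DZ n := integrableZl measurableT 2 (intDZ n).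
have intZn2 n : P.-integrable [set: T] (EFin \o (fun w => Zn n w ^+ 2)).
  apply: (le_integrable measurableT _ _ (integrableZl measurableT n%:R (Zn_bnd n))).
    by apply/measurable_EFinP/measurable_funX; exact: (measurable_wrtT Gm).
  move=> w _ /=; rewrite lee_fin expr2 (normrM (Zn n w)) (normrM n%:R) ler_wpM2r//.
have bound n : (\int[P]_(w in B n) (Z w ^+ 2)%:E <= \int[P]_w (X w ^+ 2)%:E)%E.
  have -> : (\int[P]_(w in B n) (Z w ^+ 2)%:E = \int[P]_w (Zn n w ^+ 2)%:E)%E.
    rewrite -(integral_mul_indic P (fun w => Z w ^+ 2)); apply: eq_integral => w _.
    by rewrite /Zn /= exprMn indicE; case: (w \in B n); rewrite ?expr1n ?expr0n.
  (* The two integrals differ by 2 E[(X - Z) Zn]; the right-hand integrand is at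
     most X ^ 2 pointwise. *)
  have -> : (\int[P]_w (Zn n w ^+ 2)%:E =
      \int[P]_w (2%:E * (D w * Zn n w)%:E + (Zn n w ^+ 2)%:E))%E.
    rewrite (integralD measurableT (int2DZ n) (intZn2 n)).
    rewrite (integralZl measurableT (intDZ n)).
    by rewrite (integral_centredM Gm CD (GZn n) (intDZ n)) mule0 add0e.
  apply: le_integral => //.
    exact: (integrableD measurableT (int2DZ n) (intZn2 n)).
  move=> w _; rewrite -EFinM -EFinD lee_fin /D /Zn /= indicE.
  have := sqr_ge0 (X w - Z w); have := sqr_ge0 (X w).
  by case: (w \in B n); rewrite ?mulr1 ?mulr0 /=; nra.
apply: Lfun2_integral_sqr => //.
have X2oo : (\int[P]_w (X w ^+ 2)%:E < +oo)%E by exact: integrable_lty X2i.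
apply: le_lt_trans X2oo.
have UB : \bigcup_n B n = setT.
  apply/seteqP; split => // w _; exists (Num.bound `|Z w|) => //.
  by rewrite /B /= ltW// archi_boundP.
rewrite -UB.
have : (\int[P]_(w in B n) (Z w ^+ 2)%:E @[n --> \oo] -->
    \int[P]_(w in \bigcup_n B n) (Z w ^+ 2)%:E)%E.
  apply: ge0_nondecreasing_set_cvg_integral => //.
  - move=> m n mn; apply/subsetPset => w /= /le_trans; apply.
    by rewrite ler_nat.
  - move=> n; apply: (measurable_funS measurableT) => //.
    exact/measurable_EFinP/measurable_funX.
  - by move=> n w _; rewrite lee_fin sqr_ge0.
move=> cvgB; rewrite {2}UB.
by apply: (cvge_to_le cvgB); apply: nearW.
Qed.

End square_integrable.

(** * Sigma-algebras generated by an independent family *)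

Section independent_family.
Context d (T : measurableType d) (R : realType) (P : probability T R).
Context (I : choiceType) (X : I -> {RV P >-> R}).

Definition generators (S : set I) : set (set T) :=
  \bigcup_(s in S) preimage_set_system [set: T] (X s) measurable.

(** A pi-system generating the same sigma-algebra as [generators S], on which
    independence is directly expressed. *)
Definition cylinders (S : set I) : set (set T) :=
  [set C | exists J : {fset I}, exists B : I -> set R,
    [/\ [set` J] `<=` S, forall i, measurable (B i) &
        C = \bigcap_(i in [set` J]) (X i @^-1` B i)]].

Lemma generators_measurable S : generators S `<=` measurable.
Proof. by move=> _ [s _] [B mB <-]; exact: (measurable_funP (X s)). Qed.

Lemma cylinders_sigma S : cylinders S `<=` <<s generators S >>.
Proof.
move=> _ [J [B [JS mB ->]]]; rewrite bigcap_fset.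
have sT : <<s generators S >> [set: T].
  exact: (@measurableT _ (g_sigma_algebraType _)).
rewrite big_seq; elim/big_ind: _ => //.
  by move=> A1 A2; exact: (@measurableI _ (g_sigma_algebraType _)).
move=> i iJ; apply: sub_sigma_algebra; exists i; first exact: JS.
by exists (B i) => //; rewrite setTI.
Qed.

Lemma generators_cylinders S : generators S `<=` cylinders S.
Proof.
move=> _ [s Ss [B mB <-]]; exists [fset s]%fset, (fun=> B); split => //.
  by move=> i /=; rewrite inE => /eqP ->.
by rewrite setTI set_fset1 bigcap_set1.
Qed.

Lemma g_sigma_cylinders S : <<s generators S >> = <<s cylinders S >>.
Proof.
apply/seteqP; split.
  exact: (sub_smallest2r (smallest_sigma_algebra _ _) (@generators_cylinders S)).
apply: smallest_sub; first exact: smallest_sigma_algebra.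
exact: cylinders_sigma.
Qed.

Lemma cylinders_measurable S : cylinders S `<=` measurable.
Proof.
move=> C /cylinders_sigma.
by apply: g_sigma_sub_measurable; exact: generators_measurable.
Qed.

Lemma cylinders_setI S : setI_closed (cylinders S).
Proof.
move=> _ _ [J1 [B1 [J1S mB1 ->]]] [J2 [B2 [J2S mB2 ->]]].
exists (J1 `|` J2)%fset.
exists (fun i => (if i \in J1 then B1 i else setT) `&`
                 (if i \in J2 then B2 i else setT)); split.
- by move=> i /=; rewrite inE => /orP[/J1S|/J2S].
- by move=> i; apply: measurableI; case: ifP.
- apply/seteqP; split => w /=.
    by move=> [w1 w2] i /=; rewrite inE => _; split; case: ifP => // iJ;
      [exact: w1|exact: w2].
  by move=> wJ; split => i /= iJ; have := wJ i; rewrite /= inE iJ ?orbT => /(_ isT)[].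
Qed.

Lemma g_sigma_generators_le S S' : S `<=` S' ->
  <<s generators S >> `<=` <<s generators S' >>.
Proof.
move=> SS'; have SS's : generators S `<=` generators S'.
  by move=> A [s Ss GA]; exists s => //; exact: SS'.
exact: (sub_smallest2r (smallest_sigma_algebra _ _) SS's).
Qed.

Hypothesis indep : mutually_independent X.

Lemma cylinders_indep S S' A C : S `&` S' `<=` set0 ->
  cylinders S A -> cylinders S' C -> P (A `&` C) = (P A * P C)%E.
Proof.
move=> SS' [J1 [B1 [J1S mB1 ->]]] [J2 [B2 [J2S mB2 ->]]].
have J12 i : i \in J2 -> i \notin J1.
  by move=> iJ2; apply/negP => iJ1; apply: (SS' i); split; [exact: J1S|exact: J2S].
pose B i := if i \in J1 then B1 i else B2 i.
have JE : perm_eq (J1 `|` J2)%fset (J1 ++ J2).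
  apply: uniq_perm => //.
    rewrite cat_uniq !fset_uniq /= andbT; apply/hasPn => i; exact: J12.
  by move=> i; rewrite inE mem_cat.
have -> : \bigcap_(i in [set` J1]) (X i @^-1` B1 i) =
    \bigcap_(i in [set` J1]) (X i @^-1` B i).
  by apply: eq_bigcapr => i /= iJ; rewrite /B iJ.
have -> : \bigcap_(i in [set` J2]) (X i @^-1` B2 i) =
    \bigcap_(i in [set` J2]) (X i @^-1` B i).
  by apply: eq_bigcapr => i /= iJ; rewrite /B (negPf (J12 _ iJ)).
rewrite -bigcap_setU.
have -> : [set` J1] `|` [set` J2] = [set` (J1 `|` J2)%fset].
  by apply/seteqP; split => i /=; rewrite inE => /orP.
have mB i : measurable (B i) by rewrite /B; case: ifP.
by rewrite !indep// (perm_big _ JE) big_cat.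
Qed.

Lemma centred_cylinder S S' C : S `&` S' `<=` set0 -> cylinders S' C ->
  centred P <<s generators S >> (fun w => \1_C w - fine (P C)).
Proof.
move=> SS' S'C; rewrite g_sigma_cylinders.
have mC := cylinders_measurable S'C.
have int1 : P.-integrable [set: T] (EFin \o \1_C) by exact: integrable_indic.
have intp : P.-integrable [set: T] (EFin \o cst (fine (P C))).
  exact: finite_measure_integrable_cst.
have PCfin : P C \is a fin_num by exact: fin_num_measure.
have key A : measurable A -> (P (A `&` C) = P A * P C)%E ->
    (\int[P]_(w in A) (\1_C w - fine (P C))%:E = 0)%E.
  move=> mA PAC; under eq_integral do rewrite EFinB.
  rewrite integralB_EFin//; [|exact: integrableS int1|exact: integrableS intp].
  have -> : (\int[P]_(w in A) (\1_C w)%:E = P A * P C)%E.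
    by rewrite integral_indic// setIC; exact: PAC.
  rewrite integral_cst// fineK// muleC subee//.
  by rewrite fin_numM// fin_num_measure.
apply: centred_g_sigma.
- exact: cylinders_measurable.
- exact: cylinders_setI.
- by apply: key => //; rewrite setTI probability_setT mul1e.
- split; first exact: eq_integrable (integrableB measurableT int1 intp).
  move=> A SA; apply: key; first exact: cylinders_measurable SA.
  exact: cylinders_indep SA S'C.
Qed.

(** In terms of conditional expectations: if Y is measurable with respect to the
    coordinates in S, then E[Y | S'] = E[Y | S and S'], here for a vanishing
    right-hand side.  A cylinder over S' is an event C1 on the coordinates in S
    intersected with an event C2 on the other ones, and
    E[Y 1_C1 1_C2] = E[Y 1_C1] P(C2) since C2 is independent of Y 1_C1. *)
Lemma centred_sigma S S' (Y : T -> R) :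
  measurable_wrt <<s generators S >> Y ->
  centred P <<s generators (S `&` S') >> Y -> centred P <<s generators S' >> Y.
Proof.
move=> SY [intY Y0]; rewrite g_sigma_cylinders.
apply: centred_g_sigma.
- exact: cylinders_measurable.
- exact: cylinders_setI.
- by apply: Y0; exact: (@measurableT _ (g_sigma_algebraType _)).
split => //.
move=> _ [J [B [JS' mB ->]]].
pose J1 := [fset i in J | i \in S]%fset; pose J2 := [fset i in J | i \notin S]%fset.
pose C1 := \bigcap_(i in [set` J1]) (X i @^-1` B i).
pose C2 := \bigcap_(i in [set` J2]) (X i @^-1` B i).
have -> : \bigcap_(i in [set` J]) (X i @^-1` B i) = C1 `&` C2.
  rewrite /C1 /C2 -bigcap_setU; congr (\bigcap_(i in _) _).
  apply/seteqP; split => i /=; rewrite !inE.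
    by move=> ->; case: (i \in S); [left|right].
  by case=> /andP[].
have SC1 : cylinders (S `&` S') C1.
  exists J1, B; split => // i /=; rewrite !inE => /andP[/JS' ?]; rewrite inE.
  by split.
have SC2 : cylinders (~` S) C2.
  by exists J2, B; split => // i /=; rewrite !inE => /andP[_]; rewrite notin_setE.
have mC1 := cylinders_measurable SC1.
have mC2 := cylinders_measurable SC2.
set p := fine (P C2).
have CC2 : centred P <<s generators S >> (fun w => \1_C2 w - p).
  by apply: centred_cylinder SC2; rewrite setICr.
have SC1' : <<s generators S >> C1.
  by apply: g_sigma_generators_le (cylinders_sigma SC1); exact: subIsetl.
have mY1 : measurable_wrt <<s generators S >> (Y \* \1_C1).
  by apply: measurable_wrtM => //; exact: measurable_wrt_indic.
have intY1 := integrable_mul_indic intY mC1.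
have intY12 := integrable_mul_indic intY1 mC2.
have intY1p := integrableZl measurableT p intY1.
have intcY : P.-integrable [set: T] (EFin \o ((fun w => \1_C2 w - p) \* (Y \* \1_C1))).
  apply: eq_integrable (integrableB _ intY12 intY1p) => // w _ /=.
  by rewrite -EFinD; congr EFin; ring.
have := integral_centredM (@generators_measurable S) CC2 mY1 intcY.
have -> : (\int[P]_w ((\1_C2 w - p) * (Y \* \1_C1) w)%:E =
    \int[P]_w ((Y \* \1_C1 \* \1_C2) w)%:E - \int[P]_w (p%:E * ((Y \* \1_C1) w)%:E))%E.
  rewrite -(integralB measurableT intY12 intY1p); apply: eq_integral => w _ /=.
  by rewrite -EFinD; congr EFin; ring.
rewrite (integralZl measurableT intY1) (integral_mul_indic P Y).
rewrite Y0; last exact: cylinders_sigma.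
rewrite mule0 sube0 => <-.
rewrite -(integral_mul_indic P Y) indicI; apply: eq_integral => w _ /=.
by rewrite mulrA.
Qed.

End independent_family.

(** * The poset of subgraphs *)

Lemma bigraph_inj (F F' : bigraph) :
  rows F = rows F' -> cols F = cols F' -> edges F = edges F' -> F = F'.
Proof.
case: F F' => [r c e s] [r' c' e' s'] /= rr cc ee; subst.
by congr Bigraph; exact: bool_irrelevance.
Qed.

Lemma subgraph_refl F : subgraph F F.
Proof. by rewrite /subgraph !fsubset_refl. Qed.

Lemma subgraph_trans F' F G : subgraph F F' -> subgraph F' G -> subgraph F G.
Proof.
move=> /and3P[r c e] /and3P[r' c' e']; apply/and3P; split.
- exact: fsubset_trans r r'.
- exact: fsubset_trans c c'.
- exact: fsubset_trans e e'.
Qed.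

Lemma subgraph_anti F G : subgraph F G -> subgraph G F -> F = G.
Proof.
move=> /and3P[r c e] /and3P[r' c' e'].
by apply: bigraph_inj; apply/eqP; rewrite eqEfsubset ?r ?c ?e.
Qed.

Lemma sites_le F G : subgraph F G -> sites F `<=` sites G.
Proof.
move=> /and3P[/fsubsetP r /fsubsetP c /fsubsetP e] [[i|j]|ij] /=;
  by [exact: r|exact: c|exact: e].
Qed.

Fact meet_edges_sub F G :
  (edges F `&` edges G `<=` (rows F `&` rows G) `*` (cols F `&` cols G))%fset.
Proof.
apply/fsubsetP => ij; rewrite inE => /andP[].
move=> /(fsubsetP (edges_sub F)) + /(fsubsetP (edges_sub G)).
by rewrite !in_fsetM !inE => /andP[-> ->] /andP[-> ->].
Qed.

Definition meet_graph F G := Bigraph (@meet_edges_sub F G).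

Lemma sites_meet F G : sites (meet_graph F G) = sites F `&` sites G.
Proof.
apply/seteqP; split => [[[i|j]|ij]|[[i|j]|ij]] /=; rewrite inE => /andP //.
Qed.

Lemma meet_graph_le F G : subgraph (meet_graph F G) F.
Proof. by apply/and3P; split; exact: fsubsetIl. Qed.

Lemma meet_graph_proper F G : ~~ subgraph F G -> proper_subgraph (meet_graph F G) F.
Proof.
move=> FG; rewrite /proper_subgraph meet_graph_le /=; apply: contraNneq FG => <-.
by apply/and3P; split; exact: fsubsetIr.
Qed.

Definition graph_size (F : bigraph) := (#|` rows F| + #|` cols F| + #|` edges F|)%N.

Lemma graph_size_proper F G : proper_subgraph F G -> (graph_size F < graph_size G)%N.
Proof.
move=> /andP[/and3P[r c e] FG].
have le := leqif_add (leqif_add (fsubset_leqif_cards r) (fsubset_leqif_cards c))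
  (fsubset_leqif_cards e).
rewrite /graph_size (ltn_leqif le); apply: contraNN FG.
by move=> /andP[/andP[/eqP rE /eqP cE] /eqP eE]; apply/eqP/bigraph_inj.
Qed.

(** * The decomposition *)

Section decomposition.
Context d (T : measurableType d) (R : realType) (P : probability T R).
Variables (xi eta : nat -> {RV P >-> R}) (zeta : nat -> nat -> {RV P >-> R}).
Hypothesis indep : mutually_independent (array xi eta zeta).

Local Notation sigmaH := (sigmaH xi eta zeta).
Local Notation L2 := (L2 xi eta zeta).
Local Notation L2star := (L2star xi eta zeta).

Lemma sigmaH_measurable F : sigmaH F `<=` measurable.
Proof. by apply: g_sigma_sub_measurable; exact: generators_measurable. Qed.

Lemma sigmaH_le F G : subgraph F G -> sigmaH F `<=` sigmaH G.
Proof. by move=> /sites_le; exact: g_sigma_generators_le. Qed.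

Lemma L2_le F G : subgraph F G -> L2 F `<=` L2 G.
Proof.
by move=> FG X [X2 mX]; split => //; exact: subset_trans mX (sigmaH_le FG).
Qed.

Lemma L2_subspace G : linear_subspace (L2 G).
Proof.
split.
- split; [exact: Lfun_cst|exact: measurable_wrt_cst].
- move=> X Y [X2 mX] [Y2 mY]; split; last exact: measurable_wrtD.
  have p2 : (1 <= 2%:E :> \bar R)%E by rewrite lee1n.
  by have [_ LD] := Lfun_addr_closed P p2; exact: LD.
- move=> a X [X2 mX]; split.
    have r2 : (1 <= 2 :> R) by rewrite ler1n.
    have := Lfun_scale a r2 X2.
    by have -> : a \o* X = (fun w => a * X w) by apply/funext => w /=; rewrite mulrC.
  have ma := @measurable_wrt_cst _ T R (generators (array xi eta zeta) (sites G)) a.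
  exact: measurable_wrtM ma mX.
Qed.

Lemma L2starP F X : L2star F X <->
  L2 F X /\ forall F', proper_subgraph F' F -> centred P (sigmaH F') X.
Proof.
split=> -[[X2 mX] X0]; split => // F' F'F.
- split; first exact: Lfun2_integrable.
  by move=> A; have [_ _ X0'] := X0 _ F'F; move=> /X0' <-; rewrite integral0.
- have [intX {}X0] := X0 _ F'F; split.
  + exact: measurable_wrt_cst.
  + exact: integrable0.
  + by move=> A /X0 ->; rewrite integral0.
Qed.

Lemma L2star_subspace F : linear_subspace (L2star F).
Proof.
have [V0 VD VZ] := L2_subspace F.
have W F' := centred_subspace P (@sigmaH_measurable F').
split.
- by apply/L2starP; split => // F' _; case: (W F').
- move=> X Y /L2starP[X2 X0] /L2starP[Y2 Y0]; apply/L2starP; split; first exact: VD.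
  by move=> F' F'F; case: (W F') => _ + _; apply; [exact: X0|exact: Y0].
- move=> a X /L2starP[X2 X0]; apply/L2starP; split; first exact: VZ.
  by move=> F' F'F; case: (W F') => _ _; apply; exact: X0.
Qed.

(** X depends on the coordinates in F, so it suffices that it is centred on the
    meet of F and F', which is a proper subgraph of F. *)
Lemma L2star_centred F F' X : ~~ subgraph F F' -> L2star F X ->
  centred P (sigmaH F') X.
Proof.
move=> FF' /L2starP[[X2 mX] X0]; apply: (centred_sigma indep mX).
by rewrite -sites_meet; exact: X0 (meet_graph_proper FF').
Qed.

Lemma centred_orthogonal F X Y : X \in Lfun P 2%:E -> centred P (sigmaH F) X ->
  L2 F Y -> (\int[P]_w (X w * Y w)%:E = 0)%E.
Proof.
move=> X2 CX [Y2 mY].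
apply: integral_centredM CX mY (integrable_Lfun2M X2 Y2).
exact: generators_measurable.
Qed.

Lemma L2star_orthogonal F F' X Y : F != F' -> L2star F X -> L2star F' Y ->
  (\int[P]_w (X w * Y w)%:E = 0)%E.
Proof.
have half F1 F2 U V : ~~ subgraph F1 F2 -> L2star F1 U -> L2star F2 V ->
    (\int[P]_w (U w * V w)%:E = 0)%E.
  move=> F12 U1 V2; apply: (centred_orthogonal _ (L2star_centred F12 U1)).
    by case: U1 => -[].
  by case: V2.
move=> FF' XF YF'.
have [FF'le|] := boolP (subgraph F F'); last by move=> /half; apply.
have : ~~ subgraph F' F by apply: contraNN FF' => F'F; apply/eqP/subgraph_anti.
by move=> /half/(_ YF' XF); under eq_integral do rewrite mulrC.
Qed.

Lemma L2_projection F X : X \in Lfun P 2%:E ->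
  exists Z, L2 F Z /\ centred P (sigmaH F) (X \- Z).
Proof.
move=> X2; have intX := Lfun2_integrable X2.
have Gm := @generators_measurable _ _ _ P _ (array xi eta zeta) (sites F).
have [Z EZ] := cond_expectation_exists Gm intX; exists Z; split.
  by split; [exact: cond_expectation_Lfun2 Gm X2 EZ|case: EZ].
exact: cond_expectation_centred (@sigmaH_measurable F) intX EZ.
Qed.

(** The recursion defining Y, carried out for the graphs of size less than n.
    The second conclusion says that the sum of Y over the subgraphs of F is
    E[X | H(F)]. *)
Lemma L2star_partial_decomposition G X n : L2 G X ->
  let S := fset_set [set F | subgraph F G] in
  exists Y : bigraph -> T -> R, forall F, subgraph F G -> (graph_size F < n)%N ->
    L2star F (Y F) /\
    centred P (sigmaH F) (fun w => X w - \sum_(F' <- S | subgraph F' F) Y F' w).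
Proof.
move=> XG S.
have inS F : (F \in S) = subgraph F G.
  rewrite (in_fset_set (finite_subgraphs G)).
  by apply/idP/idP => [/set_mem|FG]; [|exact: mem_set].
elim: n => [|n [Y IHY]]; first by exists (fun=> cst 0).
have [Z ZP] : exists Z : bigraph -> T -> R, forall F,
    L2 F (Z F) /\ centred P (sigmaH F) (X \- Z F).
  by have [X2 _] := XG; have [Z ?] := choice (fun F => L2_projection F X2); exists Z.
pose U F w := \sum_(F' <- S | proper_subgraph F' F) Y F' w.
pose Y' F := if (graph_size F < n)%N then Y F else Z F \- U F.
have Y'E F : (graph_size F < n)%N -> Y' F = Y F by rewrite /Y' => ->.
exists Y' => F FG; rewrite ltnS leq_eqVlt => /predU1P[Fn|Fn]; last first.
  rewrite Y'E//; have [YF CF] := IHY _ FG Fn; split => //.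
  congr (centred P (sigmaH F) _) : CF; apply/funext => w; congr (_ - _).
  apply: eq_bigr => F' F'F; rewrite Y'E//; apply: leq_ltn_trans Fn.
  have [->//|F'ne] := eqVneq F' F.
  by apply/ltnW/graph_size_proper; rewrite /proper_subgraph F'F.
have pn F' : proper_subgraph F' F -> (graph_size F' < n)%N.
  by rewrite -Fn; exact: graph_size_proper.
have Y'F : Y' F = Z F \- U F by rewrite /Y' Fn ltnn.
have [ZF ZX] := ZP F.
have IHp F' : proper_subgraph F' F -> L2star F' (Y F').
  move=> F'F; apply: (IHY _ _ (pn _ F'F)).1.
  by case/andP: F'F => F'F _; exact: subgraph_trans F'F FG.
split.
- rewrite Y'F; apply/L2starP; split.
    apply: linear_subspaceB => //; first exact: L2_subspace.
    apply: linear_subspace_sum; first exact: L2_subspace.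
    by move=> F' F'F; case/andP: (F'F) => /L2_le F'L2 _; apply: F'L2; case: (IHp _ F'F).
  move=> H HF; have [HF' _] := andP HF.
  have HG := subgraph_trans HF' FG.
  have V := centred_subspace P (@sigmaH_measurable H).
  have [_ CH] := IHY _ HG (pn _ HF).
  (* Split X - Z F off, and sort the graphs F' summed in U F by whether they are
     subgraphs of H; each of the three resulting terms is centred on H. *)
  have UE : Z F \- U F = ((fun w => X w - \sum_(F' <- S | subgraph F' H) Y F' w)
      \- (X \- Z F)) \-
      (fun w => \sum_(F' <- S | proper_subgraph F' F && ~~ subgraph F' H) Y F' w).
    apply/funext => w /=; rewrite /U (bigID (fun F' => subgraph F' H)) /=.
    rewrite (eq_bigl (fun F' => subgraph F' H)) => [|F']; first by ring.
    apply/andP/idP => [[]//|F'H]; split => //.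
    rewrite /proper_subgraph (subgraph_trans F'H HF') /=.
    apply: contraTneq HF => F'F; rewrite /proper_subgraph HF' negbK.
    by apply/eqP/subgraph_anti => //; rewrite -F'F.
  rewrite UE; apply: linear_subspaceB => //; first apply: linear_subspaceB => //.
    exact: centred_sub (sigmaH_le HF') _ ZX.
  apply: linear_subspace_sum => // F' /andP[F'F F'H].
  exact: L2star_centred F'H (IHp _ F'F).
- congr (centred P (sigmaH F) _) : ZX; apply/funext => w /=; congr (_ - _).
  rewrite big_mkcond (bigD1_seq F) /=; [|by rewrite inS|exact: fset_uniq].
  rewrite subgraph_refl Y'F /= -[LHS](subrK (U F w)); congr (_ + _).
  rewrite /U big_mkcond [RHS]big_mkcond; apply: eq_bigr => F' _ /=.
  rewrite /proper_subgraph; case: eqP => /= [_|/eqP F'F]; first by rewrite andbF.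
  by rewrite andbT; case: ifPn => // F'le; rewrite Y'E// pn// /proper_subgraph F'le.
Qed.

Lemma L2_decomposition G X : L2 G X -> exists Y : bigraph -> T -> R,
  (forall F, subgraph F G -> L2star F (Y F)) /\
  X = (fun w => \sum_(F \in [set F | subgraph F G]) Y F w) %[ae P].
Proof.
move=> XG; have [Y YP] := L2star_partial_decomposition (graph_size G).+1 XG.
have size_le F : subgraph F G -> (graph_size F < (graph_size G).+1)%N.
  move=> FG; rewrite ltnS; have [->//|FneG] := eqVneq F G.
  by apply/ltnW/graph_size_proper; rewrite /proper_subgraph FG.
have Ystar F : subgraph F G -> L2star F (Y F).
  by move=> FG; have [] := YP _ FG (size_le _ FG).
exists Y; split => //.
have [_] := YP _ (subgraph_refl G) (size_le _ (subgraph_refl G)).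
set D := (fun w => _) => CD.
(* D is orthogonal to L2 G and belongs to it. *)
have DG : L2 G D.
  apply: linear_subspaceB => //; first exact: L2_subspace.
  apply: linear_subspace_sum; first exact: L2_subspace.
  by move=> F FG; apply: (L2_le FG); case: (Ystar _ FG).
have D2 : D \in Lfun P 2%:E by case: DG.
have := Lfun2_sqr0_ae D2 (centred_orthogonal D2 CD DG).
apply: filterS => w /= + _ => /(_ I) /eqP.
rewrite subr_eq0 fsbig_finite; last exact: finite_subgraphs.
move=> /eqP ->; rewrite big_seq_cond [RHS]big_seq_cond; apply: eq_bigl => F.
rewrite in_fset_set; last exact: finite_subgraphs.
by rewrite andbT; apply/andP/idP => [[]//|/[dup] /set_mem].
Qed.

(** The difference U_F of the F-components is orthogonal to the sum of the other
    differences, which is almost surely its opposite. *)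
Lemma L2star_sum_unique G (Y Z : bigraph -> T -> R) :
  (forall F, subgraph F G -> L2star F (Y F)) ->
  (forall F, subgraph F G -> L2star F (Z F)) ->
  (fun w => \sum_(F \in [set F | subgraph F G]) Y F w) =
    (fun w => \sum_(F \in [set F | subgraph F G]) Z F w) %[ae P] ->
  forall F, subgraph F G -> Z F = Y F %[ae P].
Proof.
move=> Ystar Zstar YZ F FG.
pose U F' := Z F' \- Y F'.
have Ustar F' : subgraph F' G -> L2star F' (U F').
  move=> F'G; apply: linear_subspaceB; first exact: L2star_subspace.
    exact: Zstar.
  exact: Ystar.
have [[U2 _] _] := Ustar _ FG.
have finG := finite_subgraphs G.
pose S := fset_set [set F' | subgraph F' G].
have inS F' : (F' \in S) = subgraph F' G.
  by rewrite in_fset_set//; apply/idP/idP => [/set_mem|?]; [|exact: mem_set].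
pose V w := \sum_(F' <- S | subgraph F' G && (F' != F)) U F' w.
have [intUV UV0] : orthocomplement P (U F) V.
  apply: linear_subspace_sum; first exact: orthocomplement_subspace.
  move=> F' /andP[F'G F'F]; split.
    by apply: integrable_Lfun2M => //; case: (Ustar _ F'G) => -[].
  by apply: L2star_orthogonal (Ustar _ FG) (Ustar _ F'G); rewrite // eq_sym.
have UVae : U F = (fun w => - V w) %[ae P].
  apply: filterS YZ => w /= /(_ I) + _; rewrite !fsbig_finite//= => YZw.
  apply/eqP; rewrite -addr_eq0; apply/eqP.
  transitivity (\sum_(F' <- S) U F' w); last first.
    by rewrite sumrB -/S in YZw *; rewrite YZw subrr.
  rewrite (bigD1_seq F) ?inS ?fset_uniq//=; congr (_ + _).
  rewrite /V big_seq_cond [RHS]big_seq_cond; apply: eq_bigl => F'.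
  by rewrite inS andbA andbb.
have UU0 : (\int[P]_w (U F w * U F w)%:E = 0)%E.
  rewrite -[RHS]oppe0 -[in RHS]UV0.
  have -> : (- (\int[P]_w (U F w * V w)%:E) = \int[P]_w (-1%:E * (U F w * V w)%:E))%E.
    by rewrite (integralZl measurableT intUV) mulN1e.
  apply: ae_eq_integral => //.
  - exact: measurable_int (integrable_Lfun2M U2 U2).
  - exact: measurable_int (integrableZl measurableT (-1) intUV).
  - apply: filterS UVae => w /(_ I) UVw _.
    by rewrite -EFinM {2}UVw; congr EFin; ring.
have := Lfun2_sqr0_ae U2 UU0.
by apply: filterS => w /= /(_ I) /eqP; rewrite /U /= subr_eq0 => /eqP.
Qed.

End decomposition.

Theorem theorem2p2 (d : measure_display) (T : measurableType d) (R : realType)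
    (P : probability T R)
    (xi eta : nat -> {RV P >-> R}) (zeta : nat -> nat -> {RV P >-> R})
    (indep : mutually_independent (array xi eta zeta))
    (unif : forall s : site, uniform01 (array xi eta zeta s))
    (G : bigraph) :
  orthogonal_direct_sum P
    (L2 xi eta zeta G) [set F | subgraph F G] (L2star xi eta zeta).
Proof.
split.
- exact: L2_subspace.
- move=> F /= FG; split; first exact: L2star_subspace.
  by move=> X [XF _]; exact: L2_le FG X XF.
- move=> F F' X Y _ _ FF' XF YF'; rewrite unlock.
  exact: L2star_orthogonal FF' XF YF'.
- move=> X XG; have [Y [Ystar XY]] := L2_decomposition indep XG.
  exists Y; split => // Z Zstar XZ.
  apply: (L2star_sum_unique indep Ystar Zstar).
  exact: ae_eq_trans (ae_eq_sym XY) XZ.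
Qed.
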